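(* Let $q\ge2$ be an integer. If a group $K$ acts on a group $H$ by automorphisms such that the induced action on $H^{\mathrm{ab}}\otimes(\mathbb Z/q)$ is trivial, then $H\rtimes K$ is RTN$_q$ if and only if $H$ and $K$ are.
   Context: A $q$-group is a group $G$ for which there is an integer $t\ge1$ such that $g^{q^t}=1$ for all $g\in G$ ($G$ need not be finite). A group $G$ is RTN$_q$ (residually a nilpotent $q$-group) if for every $g\in G\setminus\{1\}$ there is a surjective morphism from $G$ onto a nilpotent $q$-group whose value at $g$ is non-trivial. $H^{\mathrm{ab}}$ is the abelianization of $H$. *)

(* Defs.v *)
From HB Require Import structures.
From mathcomp Require Import all_boot all_algebra.
From mathcomp Require Import boolp classical_sets.
From mathcomp Require Import freeg.

Set Implicit Arguments.
Unset Strict Implicit.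
Unset Printing Implicit Defensive.

Local Open Scope classical_set_scope.
Local Open Scope group_scope.
Local Open Scope quotient_scope.

(* Groups are MathComp's [groupType]s: possibly infinite, carried by a        *)
(* [choiceType] (every type is one under the classical axioms in use).        *)

(* The magma morphisms between groups that preserve 1, i.e. group morphisms;   *)
(* [groupType]s have no dedicated morphism structure.                         *)
Notation ghom G L := (monoid.UMagmaMorphism.type G L).

Definition gen (G : groupType) : set G -> set G :=
  smallest (fun S => S 1 /\ forall x y, S x -> S y -> S (x / y)).

Definition commg_sub (G : groupType) (A B : set G) : set G :=
  gen [set [~ x, y] | x in A & y in B].

Definition derived (G : groupType) : set G := commg_sub setT setT.

Fixpoint lower_central (G : groupType) (n : nat) : set G :=
  if n is m.+1 then commg_sub (lower_central m) setT else setT.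

Definition nilpotent_group (G : groupType) : Prop :=
  exists n, @lower_central G n = [set 1].

(* The exponent q ^ t is uniform in the element.                              *)
Definition q_group (q : nat) (G : groupType) : Prop :=
  exists2 t : nat, (1 <= t)%N & forall g : G, g ^+ (q ^ t)%N = 1.

Definition RTN (q : nat) (G : groupType) : Prop :=
  forall g : G, g <> 1 ->
    exists (Q : groupType) (f : ghom G Q),
      [/\ nilpotent_group Q, q_group q Q, forall y, exists x, f x = y
        & f g <> 1].

(* An action by automorphisms; bijectivity of each [a k] follows from the two *)
(* action laws.                                                               *)
Record aut_action (K H : groupType) := AutAction {
  aut_act :> K -> ghom H H;
  aut_act1 : forall h, aut_act 1 h = h;
  aut_actM : forall k l h, aut_act (k * l) h = aut_act k (aut_act l h)
}.

(* An alias of H * K, kept apart from it because MathComp already equips the  *)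
(* cartesian product with the direct product structure.                       *)
Definition sdprod (K H : groupType) (a : aut_action K H) : Type := (H * K)%type.

Section SemidirectProduct.
Variables (K H : groupType) (a : aut_action K H).
Implicit Types x y : sdprod a.

Definition sdmul x y : sdprod a := (x.1 * a x.2 y.1, x.2 * y.2).
Definition sdone : sdprod a := (1, 1).
Definition sdinv x : sdprod a := (a x.2^-1 x.1^-1, x.2^-1).

Fact sdmulA : associative sdmul.
Proof.
by move=> x y z; rewrite /sdmul /= gmulfM -aut_actM !mulgA.
Qed.

Fact sdmul1 : left_id sdone sdmul.
Proof. by case=> h k; rewrite /sdmul /= aut_act1 !mul1g. Qed.

Fact sdmulr1 : right_id sdone sdmul.
Proof. by case=> h k; rewrite /sdmul /= gmulf1 !mulg1. Qed.

Fact sdmulV : left_inverse sdone sdinv sdmul.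
Proof.
by case=> h k; rewrite /sdmul /sdone /= -gmulfM !mulVg gmulf1.
Qed.

Fact sdmulrV : right_inverse sdone sdinv sdmul.
Proof.
by case=> h k; rewrite /sdmul /sdone /= -aut_actM !mulgV aut_act1 mulgV.
Qed.

HB.instance Definition _ := Choice.copy (sdprod a) (H * K)%type.
HB.instance Definition _ :=
  isGroup.Build (sdprod a) sdmulA sdmul1 sdmulr1 sdmulV sdmulrV.

End SemidirectProduct.

Section Generated.
Variables (G : groupType) (A : set G).

Lemma gen_sub : A `<=` gen A. Proof. exact: sub_gen_smallest. Qed.

Lemma gen_min (S : set G) : S 1 -> (forall x y, S x -> S y -> S (x / y)) ->
  A `<=` S -> gen A `<=` S.
Proof. by move=> S1 SF; apply: smallest_sub. Qed.

Lemma gen1 : gen A 1. Proof. by move=> S [[]]. Qed.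

Lemma genF x y : gen A x -> gen A y -> gen A (x / y).
Proof.
move=> Ax Ay S AS; move: (AS) => [[_ SF] _].
exact: SF (Ax _ AS) (Ay _ AS).
Qed.

Lemma genV x : gen A x -> gen A x^-1.
Proof. by move=> Ax; rewrite -div1g; apply: genF => //; apply: gen1. Qed.

Lemma genM x y : gen A x -> gen A y -> gen A (x * y).
Proof. by move=> Ax Ay; rewrite -[y]invgK; apply: genF => //; apply: genV. Qed.

End Generated.

Section Abelianization.
Variable G : groupType.

Lemma derivedR (x y : G) : derived [~ x, y].
Proof. by apply: gen_sub; exists x => //; exists y. Qed.

Lemma derivedJ (x y : G) : derived x -> derived (x ^ y).
Proof.
move=> Gx; have -> : x ^ y = x * [~ x, y] by rewrite /commg mulVKg.
exact: genM (derivedR _ _).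
Qed.

Definition ab_eq : rel G := fun x y => `[< derived (x^-1 * y) >].

Fact ab_eq_equiv : equiv_class_of ab_eq.
Proof.
split=> [x|x y|y x z].
- by apply/asboolP; rewrite mulVg; apply: gen1.
- by apply/asboolP/asboolP => /genV; rewrite invgM invgK.
- move=> /asboolP xy /asboolP yz; apply/asboolP.
  have -> : x^-1 * z = (x^-1 * y) * (y^-1 * z) by rewrite mulgA mulgK.
  exact: genM.
Qed.

Canonical ab_eq_rel := EquivRelPack ab_eq_equiv.

(* G / [G, G], written additively so as to be a Z-module.                     *)
Definition ab : Type := {eq_quot ab_eq_rel}.
HB.instance Definition _ := Choice.on ab.
HB.instance Definition _ := EqQuotient.on ab.

Lemma ab_eqP (x y : G) :
  reflect (\pi_ab x = \pi_ab y) `[< derived (x^-1 * y) >].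
Proof. exact: (eqmodP ab_eq_rel). Qed.

Lemma ab_reprP (x : G) : derived ((repr (\pi_ab x))^-1 * x).
Proof. by apply/asboolP/ab_eqP; rewrite reprK. Qed.

Definition ab_add (u v : ab) : ab := \pi_ab (repr u * repr v).
Definition ab_zero : ab := \pi_ab 1.
Definition ab_opp (u : ab) : ab := \pi_ab (repr u)^-1.

Lemma pi_abM x y : \pi_ab (x * y) = ab_add (\pi_ab x) (\pi_ab y).
Proof.
apply/esym/ab_eqP/asboolP.
set x' := repr _; set y' := repr _.
have -> : (x' * y')^-1 * (x * y) = (x'^-1 * x) ^ y' * (y'^-1 * y).
  by rewrite /conjg invgM !mulgA mulgK.
apply: genM; [apply: derivedJ; apply: ab_reprP | apply: ab_reprP].
Qed.

Fact ab_addA : associative ab_add.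
Proof.
elim/quotW=> x; elim/quotW=> y; elim/quotW=> z.
by rewrite -(pi_abM y z) -(pi_abM x y) -pi_abM -[RHS]pi_abM mulgA.
Qed.

Fact ab_addC : commutative ab_add.
Proof.
elim/quotW=> x; elim/quotW=> y; rewrite -[LHS]pi_abM -[RHS]pi_abM.
apply/esym/ab_eqP/asboolP; rewrite invgM -mulgA.
exact: derivedR.
Qed.

Fact ab_add0 : left_id ab_zero ab_add.
Proof. by elim/quotW=> x; rewrite -[LHS]pi_abM mul1g. Qed.

Fact ab_addN : left_inverse ab_zero ab_opp ab_add.
Proof.
move=> u; rewrite -[X in ab_add _ X]reprK.
by rewrite -[LHS](pi_abM (repr u)^-1) mulVg.
Qed.

HB.instance Definition _ :=
  GRing.isZmodule.Build ab ab_addA ab_addC ab_add0 ab_addN.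

End Abelianization.

Section AbelianizationMap.
Variables (G L : groupType) (f : ghom G L).

Lemma derived_map x : derived x -> derived (f x).
Proof.
move: x; apply: gen_min.
- by rewrite gmulf1; apply: gen1.
- by move=> x y fx fy; rewrite gmulfF; apply: genF.
- by move=> _ [x _ [y _ <-]]; rewrite gmulfR; apply: derivedR.
Qed.

Definition ab_map (u : ab G) : ab L := \pi_(ab L) (f (repr u)).

Lemma ab_mapE x : ab_map (\pi_(ab G) x) = \pi_(ab L) (f x).
Proof.
apply/ab_eqP/asboolP; rewrite -gmulfV -gmulfM.
by apply: derived_map; apply: ab_reprP.
Qed.

Fact ab_map_is_additive : GRing.zmod_morphism ab_map.
Proof.
have addE (u v : ab G) : ab_map (u + v)%R = (ab_map u + ab_map v)%R.
  elim/quotW: u => x; elim/quotW: v => y.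
  rewrite -[(\pi_(ab G) x + \pi_(ab G) y)%R](pi_abM x y) !ab_mapE gmulfM.
  exact: pi_abM.
move=> u v; apply/eqP.
by rewrite eq_sym GRing.subr_eq -addE GRing.subrK.
Qed.

HB.instance Definition _ :=
  GRing.isZmodMorphism.Build (ab G) (ab L) ab_map ab_map_is_additive.

End AbelianizationMap.

Import GRing.Theory.
Local Open Scope ring_scope.

Section Tensor.
Variables A B : zmodType.

Local Notation "a :@ b" := (<< (a, b) >> : {freeg (A * B)%type}) (at level 35).

Definition tensor_relator : set {freeg (A * B)%type} :=
  [set z | (exists a a' b, z = (a + a') :@ b - a :@ b - a' :@ b)
        \/ (exists a b b', z = a :@ (b + b') - a :@ b - a :@ b')].

Definition tensor_ker : {pred {freeg (A * B)%type}} := fun z =>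
  `[< smallest (fun S => S 0 /\ forall x y, S x -> S y -> S (x - y))
        tensor_relator z >].

Fact tensor_ker_closed : zmod_closed tensor_ker.
Proof.
split=> [|x y]; first by apply/asboolP => S [[]].
move=> /asboolP kx /asboolP ky; apply/asboolP => S kS.
by move: (kS) => [[_ SB] _]; apply: SB; [apply: kx | apply: ky].
Qed.

HB.instance Definition _ :=
  GRing.isZmodClosed.Build _ tensor_ker tensor_ker_closed.

(* The tensor product over the integers: the free abelian group on A * B      *)
(* modulo the bilinearity relations.                                          *)
Definition tensor : Type := {ideal_quot tensor_ker}.
HB.instance Definition _ := GRing.Zmodule.on tensor.
HB.instance Definition _ := EqQuotient.on tensor.

Definition tens (a : A) (b : B) : tensor := \pi_tensor (a :@ b).

Lemma pi_tensorD : {morph \pi_tensor : x y / x + y}.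
Proof. by move=> x y; rewrite [LHS]pi_addr. Qed.

Lemma pi_tensorB : {morph \pi_tensor : x y / x - y}.
Proof. by move=> x y; rewrite [LHS]pi_addr [X in _ + X]pi_oppr. Qed.

Lemma pi_tensor_eq x y :
  (\pi_tensor x = \pi_tensor y) <-> (x - y \in tensor_ker).
Proof. by rewrite Quotient.idealrBE; split=> [e|/eqP]; first apply/eqP. Qed.

Lemma tensor_relator_ker z : tensor_relator z -> z \in tensor_ker.
Proof. by move=> rz; apply/asboolP; apply: sub_gen_smallest. Qed.

Lemma tensDl a a' b : tens (a + a') b = tens a b + tens a' b.
Proof.
rewrite /tens -[RHS]pi_tensorD; apply/pi_tensor_eq.
by rewrite opprD addrA; apply: tensor_relator_ker; left; exists a, a', b.
Qed.

Lemma tensDr a b b' : tens a (b + b') = tens a b + tens a b'.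
Proof.
rewrite /tens -[RHS]pi_tensorD; apply/pi_tensor_eq.
by rewrite opprD addrA; apply: tensor_relator_ker; right; exists a, b, b'.
Qed.

End Tensor.

Section TensorMap.
Variables (A A' B B' : zmodType).
Variables (f : {additive A -> A'}) (g : {additive B -> B'}).

Definition tensor_lift : {freeg (A * B)%type} -> {freeg (A' * B')%type} :=
  fglift (fun p : (A * B)%type =>
            << (f p.1, g p.2) >> : {freeg (A' * B')%type}).

Fact tensor_lift_is_additive : zmod_morphism tensor_lift.
Proof. exact: lift_is_additive. Qed.

HB.instance Definition _ :=
  GRing.isZmodMorphism.Build _ _ tensor_lift tensor_lift_is_additive.

Definition tensor_map (t : tensor A B) : tensor A' B' :=
  \pi_(tensor A' B') (tensor_lift (repr t)).

Lemma tensor_liftE a b : tensor_lift << (a, b) >> = << (f a, g b) >>.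
Proof. by rewrite /tensor_lift liftU scale1r. Qed.

Lemma tensor_lift_ker z :
  z \in @tensor_ker A B -> tensor_lift z \in @tensor_ker A' B'.
Proof.
move=> /asboolP; move: z; apply: smallest_sub => /=.
  split=> [|x y xk yk]; first by rewrite raddf0 rpred0.
  by rewrite raddfB rpredB.
move=> _ [[a [a' [b ->]]]|[a [b [b' ->]]]] /=; rewrite !raddfB /=.
- rewrite !tensor_liftE raddfD; apply: tensor_relator_ker.
  by left; exists (f a), (f a'), (g b).
- rewrite !tensor_liftE raddfD; apply: tensor_relator_ker.
  by right; exists (f a), (g b), (g b').
Qed.

Lemma tensor_map_pi z :
  tensor_map (\pi_(tensor A B) z) = \pi_(tensor A' B') (tensor_lift z).
Proof.
apply/pi_tensor_eq; rewrite -raddfB; apply: tensor_lift_ker.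
by apply/pi_tensor_eq; rewrite reprK.
Qed.

Lemma tensor_mapE a b : tensor_map (tens a b) = tens (f a) (g b).
Proof. by rewrite /tens tensor_map_pi tensor_liftE. Qed.

Fact tensor_map_is_additive : zmod_morphism tensor_map.
Proof.
elim/quotW=> x; elim/quotW=> y.
by rewrite -[X in tensor_map X]pi_tensorB !tensor_map_pi raddfB pi_tensorB.
Qed.

HB.instance Definition _ :=
  GRing.isZmodMorphism.Build (tensor A B) (tensor A' B') tensor_map
    tensor_map_is_additive.

End TensorMap.

(* H^ab ⊗ (Z/q), where 'Z_q is Z/q because q >= 2 in all uses, and the        *)
(* endomorphism of it induced by an endomorphism of H.                        *)
Definition ab_mod (H : groupType) (q : nat) : Type := tensor (ab H) 'Z_q.

Definition ab_mod_map (H : groupType) (q : nat) (f : ghom H H) :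
    ab_mod H q -> ab_mod H q :=
  tensor_map (ab_map f) (idfun : {additive 'Z_q -> 'Z_q}).

Definition trivial_on_ab_mod (q : nat) (K H : groupType)
    (a : aut_action K H) : Prop :=
  forall (k : K) (t : ab_mod H q), ab_mod_map (a k) t = t.

(* Main.v *)
Require Import Defs.
From mathcomp Require Import all_boot all_algebra.
From HB Require Import structures.
From mathcomp Require Import boolp classical_sets freeg.

(** Let L_n(G) be the lower exponent-q central series of a group G: L_0(G) = G
    and L_(n+1)(G) is generated by the commutators [x, g] and the powers x^q,
    for x in L_n(G) and g in G. The quotients G / L_n(G) are nilpotent q-groups,
    and in a nilpotent q-group L_n is trivial for n large. So G is RTN_q if and
    only if the intersection of the L_n(G) is trivial ([RTN_lower_qcentral]).

    As L_n is functorial, L_n(H) and L_n(K) are contained in L_n(H ><| K), so H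
    and K are RTN_q when H ><| K is.

    For the converse it suffices that L_n(H ><| K) be contained in
    L_n(H) ><| L_n(K). As L_n is the smallest q-central series that starts with
    the whole group, this amounts to L_n(H) ><| L_n(K) being a q-central series
    ([sdprod_qcentral_series]), and this uses two facts.
    - K acts trivially on L_n(H) / L_(n+1)(H) for all n. For n = 0 this factor
      is the tensor product of the abelianization of H with Z/q, where the
      hypothesis applies ([trivial_on_ab_mod_lower_qcentral]); the case of n
      follows by induction ([lower_qcentral_action]).
    - L_m(K) acts trivially on H / L_(m+1)(H). This is a form of the three
      subgroups lemma: if G acts trivially on the factors of a series F_n, and
      these have exponent dividing q, then [F_n, L_m(G)] is contained in F_(n+m+1)
      ([qcentral_shift]). *)

Set Implicit Arguments.
Unset Strict Implicit.
Unset Printing Implicit Defensive.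

Local Open Scope classical_set_scope.
Local Open Scope group_scope.

(** * Subgroups and commutator identities *)

Definition subgrp (G : groupType) (N : set G) :=
  N 1 /\ forall x y, N x -> N y -> N (x / y).

Definition normal_subgrp (G : groupType) (N : set G) :=
  subgrp N /\ forall x y, N x -> N (x ^ y).

Lemma subgrpV (G : groupType) (N : set G) x : subgrp N -> N x -> N x^-1.
Proof. by move=> [N1 NF] Nx; rewrite -div1g; apply: NF. Qed.

Lemma subgrpM (G : groupType) (N : set G) x y :
  subgrp N -> N x -> N y -> N (x * y).
Proof. by move=> sN Nx Ny; rewrite -[y]invgK; apply: sN.2 => //; apply: subgrpV. Qed.

Lemma subgrp_gen (G : groupType) (A : set G) : subgrp (gen A).
Proof. by split; [apply: gen1 | move=> x y; apply: genF]. Qed.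

Lemma commute_conjgP (G : groupType) (x y : G) : commute x y <-> x ^ y = x.
Proof. by split=> [/commgP/conjg_fixP|/conjg_fixP/commgP]. Qed.

Lemma commute_conjg (G : groupType) (x y : G) : commute x y -> x ^ y = x.
Proof. by move/commute_conjgP. Qed.

Lemma conjgE_comm (G : groupType) (x y : G) : x ^ y = x * [~ x, y].
Proof. by rewrite /commg mulVKg. Qed.

(** Used in a quotient by a term of a central series, to see that the class of
    [~ u, v] depends only on the classes of u and v modulo earlier terms. The
    hypotheses ask for no more commutation than those terms provide: there z is
    central, but w only commutes with x and with commutators. *)
Lemma commg_mul_commuting (G : groupType) (x y z w : G) :
    commute z (y * w) -> commute z [~ x, y * w] ->
    commute x w -> commute [~ x, y] w ->
  [~ x * z, y * w] = [~ x, y].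
Proof.
move=> zyw zc xw cw; rewrite commgEl conjMg (commute_conjg zyw) invgM.
rewrite -mulgA (mulgA x^-1) -commgEl -[_ * (_ * z)]/(_ ^ z).
rewrite (commute_conjg (commute_sym zc)) commgEl conjgM [x ^ y]conjgE_comm conjMg.
by rewrite (commute_conjg xw) (commute_conjg cw) mulKg.
Qed.

(** * Quotient groups *)

Section Quotient.

Local Open Scope quotient_scope.
Variables (G : groupType) (N : set G) (nN : normal_subgrp N).

Definition coset_eq : rel G := fun x y => `[< N (x^-1 * y) >].

Fact coset_eq_equiv : equiv_class_of coset_eq.
Proof.
split=> [x|x y|y x z].
- by apply/asboolP; rewrite mulVg; apply: nN.1.1.
- by apply/asboolP/asboolP => /(subgrpV nN.1); rewrite invgM invgK.
- move=> /asboolP xy /asboolP yz; apply/asboolP.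
  have -> : x^-1 * z = (x^-1 * y) * (y^-1 * z) by rewrite mulgA mulgK.
  exact: subgrpM nN.1 _ _.
Qed.

Definition coset_eq_rel := EquivRelPack coset_eq_equiv.

Definition quot_grp : Type := {eq_quot coset_eq_rel}.
HB.instance Definition _ := Choice.on quot_grp.
HB.instance Definition _ := EqQuotient.on quot_grp.

Lemma quot_eqP (x y : G) : \pi_quot_grp x = \pi_quot_grp y <-> N (x^-1 * y).
Proof.
split=> [/(eqmodP coset_eq_rel)/asboolP //|Nxy].
exact/(eqmodP coset_eq_rel)/asboolP.
Qed.

Lemma quot_repr (x : G) : N ((repr (\pi_quot_grp x))^-1 * x).
Proof. by apply/quot_eqP; rewrite reprK. Qed.

Definition quot_mul (u v : quot_grp) : quot_grp := \pi_quot_grp (repr u * repr v).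
Definition quot_inv (u : quot_grp) : quot_grp := \pi_quot_grp (repr u)^-1.

Lemma pi_quotM x y :
  \pi_quot_grp (x * y) = quot_mul (\pi_quot_grp x) (\pi_quot_grp y).
Proof.
apply/esym/quot_eqP; set x' := repr _; set y' := repr _.
have -> : (x' * y')^-1 * (x * y) = (x'^-1 * x) ^ y' * (y'^-1 * y).
  by rewrite /conjg invgM !mulgA mulgK.
by apply: subgrpM nN.1 _ _; [apply: nN.2|]; apply: quot_repr.
Qed.

Fact quot_mulA : associative quot_mul.
Proof.
elim/quotW=> x; elim/quotW=> y; elim/quotW=> z.
by rewrite -(pi_quotM y z) -(pi_quotM x y) -pi_quotM -[RHS]pi_quotM mulgA.
Qed.

Fact quot_mul1g : left_id (\pi_quot_grp 1) quot_mul.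
Proof. by elim/quotW=> x; rewrite -[LHS]pi_quotM mul1g. Qed.

Fact quot_mulg1 : right_id (\pi_quot_grp 1) quot_mul.
Proof. by elim/quotW=> x; rewrite -[LHS]pi_quotM mulg1. Qed.

Fact quot_mulVg : left_inverse (\pi_quot_grp 1) quot_inv quot_mul.
Proof.
move=> u; rewrite -[X in quot_mul _ X]reprK.
by rewrite -[LHS](pi_quotM (repr u)^-1) mulVg.
Qed.

Fact quot_mulgV : right_inverse (\pi_quot_grp 1) quot_inv quot_mul.
Proof.
move=> u; rewrite -[X in quot_mul X _]reprK.
by rewrite -[LHS](pi_quotM (repr u)) mulgV.
Qed.

HB.instance Definition _ :=
  isGroup.Build quot_grp quot_mulA quot_mul1g quot_mulg1 quot_mulVg quot_mulgV.

Definition quot_proj (x : G) : quot_grp := \pi_quot_grp x.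

HB.instance Definition _ :=
  isUMagmaMorphism.Build G quot_grp quot_proj (erefl, pi_quotM).

End Quotient.

(** Only a surjection with the prescribed kernel is ever used, so the
    construction is hidden: congruences modulo N become equations in Q, where
    the elements of a central factor commute with everything. *)
Lemma quotient_exists (G : groupType) (N : set G) : normal_subgrp N ->
  exists (Q : groupType) (p : ghom G Q),
    (forall y, exists x, p x = y) /\ (forall x, p x = 1 <-> N x).
Proof.
move=> nN; exists (quot_grp nN), (quot_proj nN : ghom G (quot_grp nN)).
split=> [|x].
  by elim/quotW => x; exists x.
split=> [/esym/quot_eqP|Nx].
  by rewrite invg1 mul1g.
by apply/esym/quot_eqP; rewrite invg1 mul1g.
Qed.

Section ModKernel.
Variables (G Q : groupType) (p : ghom G Q) (N : set G).
Hypothesis kerp : forall x, p x = 1 <-> N x.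

Lemma ker_commute x y : N [~ x, y] <-> commute (p x) (p y).
Proof.
split=> [/kerp pxy|pxy]; last apply/kerp.
  by apply/commgP; rewrite -gmulfR pxy.
by rewrite gmulfR; apply/eqP/commgP.
Qed.

Lemma ker_eq x y : N (x^-1 * y) <-> p x = p y.
Proof.
split=> [/kerp|pxy].
  by rewrite gmulfM gmulfV => /mulg1_eq; rewrite invgK => ->.
by apply/kerp; rewrite gmulfM gmulfV pxy mulVg.
Qed.

End ModKernel.

(** * q-central series *)

Section CentralSeries.
Variable q : nat.

(** The lower exponent-q central series: among the series that start with the
    whole group and have central factors killed by q, the fastest descending. *)
Fixpoint lower_qcentral (G : groupType) (n : nat) : set G :=
  if n is m.+1 then
    gen ([set [~ x, y] | x in lower_qcentral m & y in setT] `|`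
         [set x ^+ q | x in lower_qcentral m])
  else setT.

Record qcentral_series (G : groupType) (F : nat -> set G) : Prop := QCentral {
  qcs_subgrp n : subgrp (F n);
  qcs_decr n : F n.+1 `<=` F n;
  qcs_comm n x g : F n x -> F n.+1 [~ x, g];
  qcs_exp n x : F n x -> F n.+1 (x ^+ q)
}.

Lemma qcs_normal (G : groupType) (F : nat -> set G) n :
  qcentral_series F -> normal_subgrp (F n).
Proof.
move=> sF; split=> [|x y Fx]; first exact: qcs_subgrp.
rewrite conjgE_comm.
have sFn := qcs_subgrp sF n.
by apply: (subgrpM sFn Fx); apply: (qcs_decr sF); apply: (qcs_comm sF).
Qed.

(** The main way to bound lower_qcentral from above: it is enough to recognize
    the target as a q-central series. *)
Lemma lower_qcentral_min (G : groupType) (F : nat -> set G) :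
  qcentral_series F -> (forall x, F 0 x) -> forall n, lower_qcentral n `<=` F n.
Proof.
move=> sF F0; elim=> [|n IHn] /=; first by move=> x _; apply: F0.
have [F1 FF] := qcs_subgrp sF n.+1.
apply: gen_min => // _ [[x Lx [y _ <-]]|[x Lx <-]].
  by apply: (qcs_comm sF) => //; apply: IHn.
by apply: (qcs_exp sF) => //; apply: IHn.
Qed.

Lemma lower_qcentral_series (G : groupType) : qcentral_series (@lower_qcentral G).
Proof.
have sL n : subgrp (@lower_qcentral G n).
  by case: n => [|n]; [split | apply: subgrp_gen].
have cL n x g : @lower_qcentral G n x -> lower_qcentral n.+1 [~ x, g].
  by move=> Lx; apply: gen_sub; left; exists x => //; exists g.
have eL n x : @lower_qcentral G n x -> lower_qcentral n.+1 (x ^+ q).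
  by move=> Lx; apply: gen_sub; right; exists x.
split=> //; elim=> [|n IHn] //=.
have [L1 LF] := sL n.+1.
apply: gen_min => // _ [[x /IHn Lx [y _ <-]]|[x /IHn Lx <-]].
  exact: cL.
exact: eL.
Qed.

Lemma lower_qcentral_map (G L : groupType) (f : ghom G L) n x :
  lower_qcentral n x -> lower_qcentral n (f x).
Proof.
have sL := lower_qcentral_series L.
pose F n := [set x | lower_qcentral n (f x)].
suff sF : qcentral_series F by apply: (lower_qcentral_min sF).
split=> [m|m y|m y g|m y] /=.
- split; first by rewrite /F /= gmulf1; apply: (qcs_subgrp sL m).1.
  by move=> y z Fy Fz; rewrite /F /= gmulfF; apply: (qcs_subgrp sL m).2.
- exact: (qcs_decr sL).
- by move=> Fy; rewrite /F /= gmulfR; apply: (qcs_comm sL).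
- by move=> Fy; rewrite /F /= gmulfXn; apply: (qcs_exp sL).
Qed.

(** For fixed F, let C m be the set of the g that push F n into F (n + m).+1
    for all n. Then C is itself a q-central series, and C 0 is the whole group,
    so that it contains lower_qcentral. This elementwise form of the three
    subgroups lemma gives both [lower_qcentral n, lower_qcentral m] inside
    lower_qcentral (n + m).+1 and, with F carried by the normal factor of a
    semidirect product, the action of the deeper terms of the other factor. *)
Lemma qcentral_shift (G : groupType) (F : nat -> set G) :
  qcentral_series F -> forall m n x g,
  F n x -> lower_qcentral m g -> F (n + m).+1 [~ x, g].
Proof.
move=> sF.
pose C m := [set g | forall n x, F n x -> F (n + m).+1 [~ x, g]].
suff sC : qcentral_series C.
  move=> m n x g Fx Lg; apply: (lower_qcentral_min sC) Lg n x Fx => y k z Fz.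
  by rewrite addn0; apply: (qcs_comm sF).
split=> [m|m g Cg n x Fx|m g h Cg n x Fx|m g Cg n x Fx].
- split=> [n x _|g h Cg Ch n x Fx].
    by rewrite commg1; apply: (qcs_subgrp sF _).1.
  have [Q [p [_ pK]]] := quotient_exists (qcs_normal (n + m).+1 sF).
  apply/(ker_commute pK); rewrite gmulfF; apply: commuteM.
    by apply/(ker_commute pK)/Cg.
  by apply/commuteV/(ker_commute pK)/Ch.
- by apply: (qcs_decr sF); rewrite -addnS; apply: Cg.
- have nF := qcs_normal (n + m.+1).+1 sF; have nFn := qcs_normal n sF.
  have [Q [p [_ pK]]] := quotient_exists nF.
  (* Conjugating y by g then h, or by h then g, multiplies it by the same two
     factors, of which one is central modulo F (n + m.+1).+1. *)
  have swap y : F n y -> p y ^ (p g * p h) = p y ^ (p h * p g).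
    move=> Fy; rewrite !conjgM.
    have zC u : commute (p [~ y, g]) (p u).
      by apply/(ker_commute pK); rewrite addnS; apply: (qcs_comm sF); apply: Cg.
    have wC : commute (p [~ y, h]) (p g).
      by apply/(ker_commute pK); rewrite addnS -addSn; apply: Cg; apply: (qcs_comm sF).
    have yg : p y ^ p g = p y * p [~ y, g] by rewrite gmulfR /commg mulVKg.
    have yh : p y ^ p h = p y * p [~ y, h] by rewrite gmulfR /commg mulVKg.
    rewrite yg yh !conjMg yg yh (commute_conjg (zC h)) (commute_conjg wC).
    by rewrite -!mulgA zC.
  apply/(ker_commute pK)/commute_conjgP.
  have -> : p [~ g, h] = (p h * p g)^-1 * (p g * p h).
    by rewrite gmulfR /commg /conjg invgM !mulgA.
  (* [g, h] = (h g)^-1 (g h), so swap is applied to x conjugated by (h g)^-1. *)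
  have Fy : F n (x ^ (h * g)^-1) by apply: nFn.2.
  by have := swap _ Fy; rewrite gmulfJ gmulfV gmulfM -!conjgM mulVg conjg1.
- have [Q [p [_ pK]]] := quotient_exists (qcs_normal (n + m.+1).+1 sF).
  have Fz : F (n + m).+1 [~ x, g] by apply: Cg.
  have zC u : commute (p [~ x, g]) (p u).
    by apply/(ker_commute pK); rewrite addnS; apply: (qcs_comm sF).
  have zq : p [~ x, g] ^+ q = 1.
    by rewrite -gmulfXn; apply/pK; rewrite addnS; apply: (qcs_exp sF).
  have xgk k : p x ^ (p g ^+ k) = p x * p [~ x, g] ^+ k.
    elim: k => [|k IHk]; first by rewrite conjg1 mulg1.
    rewrite expgSr conjgM IHk conjMg conjXg (commute_conjg (zC g)).
    by rewrite -gmulfJ conjgE_comm gmulfM -mulgA -expgS.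
  apply/(ker_commute pK); rewrite gmulfXn; apply/commute_conjgP.
  by rewrite xgk zq mulg1.
Qed.

Lemma lower_central_normal (G : groupType) n :
  normal_subgrp (@lower_central G n).
Proof.
have sL m : subgrp (@lower_central G m).
  by case: m => [|m]; [split | apply: subgrp_gen].
have dL m : (@lower_central G m.+1) `<=` (@lower_central G m).
  elim: m => [|m IHm] //; have [L1 LF] := sL m.+1.
  apply: gen_min => // _ [x /IHm Lx [y _ <-]].
  by apply: gen_sub; exists x => //; exists y.
split=> // x y Lx; rewrite conjgE_comm.
apply: (subgrpM (sL n) Lx); apply: dL.
by apply: gen_sub; exists x => //; exists y.
Qed.

(** Once inside the i-th term of the lower central series, and modulo the next
    one, the commutators vanish and each further step of lower_qcentral only
    takes q-th powers. *)
Lemma lower_qcentral_power (G : groupType) i n s :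
  @lower_qcentral G n `<=` lower_central i ->
  @lower_qcentral G (n + s) `<=`
    [set y | exists2 x, lower_central i x &
                        lower_central i.+1 ((x ^+ (q ^ s))^-1 * y)].
Proof.
move=> sLi.
have nLi := lower_central_normal G i.
have nL := lower_central_normal G i.+1.
have [Q [p [_ pK]]] := quotient_exists nL.
have central x y : lower_central i x -> commute (p x) (p y).
  move=> Lx; apply/(ker_commute pK).
  by apply: gen_sub; exists x => //; exists y.
elim: s => [|s IHs].
  by rewrite addn0 => y /sLi Ly; exists y => //; rewrite expg1 mulVg; apply: nL.1.1.
rewrite addnS; apply: gen_min => /=.
- by exists 1; [apply: nLi.1.1 | rewrite expg1n invg1 mul1g; apply: nL.1.1].
- move=> y z [u Lu /(ker_eq pK) uy] [v Lv /(ker_eq pK) vz].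
  exists (u / v); first by apply: nLi.1.2.
  have cuv : commute (p u) (p v) by apply: central.
  apply/(ker_eq pK); rewrite gmulfXn !gmulfF -uy -vz !gmulfXn.
  by rewrite expgnFl.
- move=> _ [[x /IHs[u Lu /(ker_eq pK) ux] [y _ <-]]|[x /IHs[u Lu /(ker_eq pK) ux] <-]].
    exists 1; first exact: nLi.1.1.
    apply/(ker_eq pK); rewrite expg1n gmulf1 gmulfR -ux gmulfXn.
    apply/esym/eqP/commgP; apply: commute_sym; apply: commuteX; apply: commute_sym.
    exact: central.
  exists u => //; apply/(ker_eq pK).
  by rewrite [in RHS]gmulfXn -ux !gmulfXn expnSr expgnA.
Qed.

(** With exponent q ^ t, the previous lemma descends one step of the lower
    central series for every t steps of lower_qcentral. *)
Lemma nilpotent_q_group_lower_qcentral (G : groupType) :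
  nilpotent_group G -> q_group q G -> exists n, @lower_qcentral G n `<=` [set 1].
Proof.
move=> [c Lc1] [t _ Gt]; exists (c * t)%N; rewrite -Lc1.
elim: {Lc1}c => [//|c IHc].
rewrite mulSn addnC => y /(lower_qcentral_power IHc) [x _].
by rewrite Gt invg1 mul1g.
Qed.

(** The property RTN becomes a statement on a series of the group itself,
    because the quotient by lower_qcentral n is a nilpotent q-group and every
    nilpotent q-group quotient factors through one of these. It makes the
    inheritance of RTN by subgroups immediate. *)
Lemma RTN_lower_qcentral (G : groupType) :
  RTN q G <-> forall g : G, g <> 1 -> exists n, ~ lower_qcentral n g.
Proof.
split=> [rG g /rG [Q [f [nQ qQ _ fg1]]]|sepG g /sepG [n Lg]].
  have [n Qn] := nilpotent_q_group_lower_qcentral nQ qQ.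
  by exists n => /(lower_qcentral_map f)/Qn.
have sL := lower_qcentral_series G.
have [Q [p [psurj pK]]] := quotient_exists (qcs_normal n sL).
exists Q, p; split=> //; last by move/pK.
- have sub m y : lower_central m y -> exists2 x, lower_qcentral m x & p x = y.
    elim: m y => [y _|m IHm]; first by have [x <-] := psurj y; exists x.
    apply: gen_min => [|y z|].
    + by exists 1; [apply: (qcs_subgrp sL _).1 | rewrite gmulf1].
    + move=> [u Lu <-] [v Lv <-]; exists (u / v); last by rewrite gmulfF.
      exact: (qcs_subgrp sL _).2.
    + move=> _ [y /IHm [u Lu <-] [z _ <-]]; have [v <-] := psurj z.
      by exists [~ u, v]; [apply: (qcs_comm sL) | rewrite gmulfR].
  exists n; apply/seteqP; split=> [y /sub[x /pK px <-] //|_ ->].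
  by have [[]] := lower_central_normal Q n.
- have Lexp m (x : G) : lower_qcentral m (x ^+ (q ^ m)%N).
    elim: m => [//|m IHm].
    by rewrite expnSr expgnA; apply: (qcs_exp sL).
  (* n.+1 instead of n, since the exponent t of a q-group is positive. *)
  exists n.+1 => // y; have [x <-] := psurj y.
  rewrite expnSr expgnA -gmulfXn.
  by have /pK -> := Lexp n x; rewrite expg1n.
Qed.

(** Triviality on the first factor propagates to all the others. Indeed
    lower_qcentral n.+1 is generated by the commutators [u, y] and the powers
    u ^+ q with u in lower_qcentral n, and modulo lower_qcentral n.+2 these
    depend only on the class of u modulo lower_qcentral n.+1 and on that of y
    modulo lower_qcentral 1. For y, the reason is that lower_qcentral n and
    lower_qcentral 1 commute modulo lower_qcentral n.+2. *)
Lemma lower_qcentral_action (H : groupType) (phi : ghom H H) :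
  (forall x, lower_qcentral 1 (x^-1 * phi x)) ->
  forall n x, lower_qcentral n x -> lower_qcentral n.+1 (x^-1 * phi x).
Proof.
move=> phi1; have sL := lower_qcentral_series H.
elim=> [//|n IHn] x Lx.
have [Q [p [_ pK]]] := quotient_exists (qcs_normal n.+2 sL).
apply/(ker_eq pK).
have central z y : lower_qcentral n.+1 z -> commute (p z) (p y).
  by move=> Lz; apply/(ker_commute pK); apply: (qcs_comm sL).
have phiE u : p (phi u) = p u * p (u^-1 * phi u) by rewrite -gmulfM mulVKg.
suff sub : lower_qcentral n.+1 `<=` [set x | p x = p (phi x)] by apply: sub.
apply: gen_min => /=.
- by rewrite !gmulf1.
- by move=> y z yE zE; rewrite !gmulfF yE zE.
- move=> _ [[u Lu [y _ <-]]|[u Lu <-]]; last first.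
    have Lz := IHn u Lu.
    rewrite /= !gmulfXn phiE expgMn; last by apply/commute_sym/central.
    have zq : p (u^-1 * phi u) ^+ q = 1.
      by rewrite -gmulfXn; apply/pK; apply: (qcs_exp sL).
    by rewrite zq mulg1.
  have Lz := IHn u Lu; have Lw := phi1 y.
  have uwC : commute (p u) (p (y^-1 * phi y)).
    apply/(ker_commute pK).
    by have := qcentral_shift sL Lu Lw; rewrite addn1.
  have uyC : commute (p [~ u, y]) (p (y^-1 * phi y)).
    by apply: central; apply: (qcs_comm sL).
  rewrite /= !gmulfR !phiE commg_mul_commuting // -?gmulfM -?gmulfR //.
  - exact: central.
  - exact: central.
Qed.

End CentralSeries.

(** * The first factor as a tensor product *)

Import GRing.Theory.

(** An additive map into a group killed by q extends to the tensor product with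
    Z/q by (x, b) |-> b f(x), and this extension recovers f x from the tensor
    of x and 1. *)
Lemma tens1_eq_additive (q : nat) (A B : zmodType) (f : {additive A -> B}) :
  (1 < q)%N -> (forall b : B, (b *+ q = 0)%R) ->
  forall x y : A, tens x (1 : 'Z_q)%R = tens y (1 : 'Z_q)%R -> f x = f y.
Proof.
move=> q1 qB x y /pi_tensor_eq/asboolP kxy.
pose L : {freeg (A * 'Z_q)%type} -> zmodule B :=
  fglift (fun u : (A * 'Z_q)%type => (f u.1 *+ (u.2 : nat))%R : zmodule B).
have LB : {morph L : u v / (u - v)%R} by apply: lift_is_additive.
have LU a b : L << (a, b) >> = (f a *+ (b : nat))%R.
  by rewrite /L liftU scale1r.
have L0 : (L << (x, 1) >> - L << (y, 1) >> = 0)%R.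
  rewrite -LB; apply: (kxy [set z | L z = 0%R]); split.
    split=> [|u v Lu Lv] /=; first by rewrite -(subrr 0%R) LB subrr.
    by rewrite LB Lu Lv subr0.
  have modB (b : B) m : (b *+ (m %% q) = b *+ m)%R.
    by rewrite [in RHS](divn_eq m q) mulrnDr mulnC mulrnA qB mul0rn add0r.
  move=> _ [[a [a' [b ->]]]|[a [b [b' ->]]]] /=; rewrite !LB !LU.
    by rewrite raddfD mulrnDl -addrA -opprD subrr.
  by rewrite /= [X in (_ %% X)%N]Zp_cast // modB mulrnDr -addrA -opprD subrr.
move: L0; rewrite !LU /= [X in (_ %% X)%N]Zp_cast // modn_small // => /eqP.
by rewrite subr_eq0 !mulr1n => /eqP.
Qed.

(** H / lower_qcentral 1 is abelian and killed by q, hence equal to its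
    abelianization, and the map from the abelianization of H to it factors
    through the tensor product with Z/q. *)
Lemma trivial_on_ab_mod_lower_qcentral (q : nat) (K H : groupType)
    (a : aut_action K H) : (1 < q)%N -> trivial_on_ab_mod q a ->
  forall k x, lower_qcentral q 1 (x^-1 * a k x).
Proof.
move=> q1 ha k x; have sL := lower_qcentral_series q H.
have [Q [p [psurj pK]]] := quotient_exists (qcs_normal 1 sL).
have abQ : @derived Q `<=` [set 1].
  apply: gen_min => [//|y z /= -> ->|_ [y _ [z _ <-]]]; first by rewrite mulgV.
  have [u <-] := psurj y; have [v <-] := psurj z.
  by rewrite -gmulfR; apply/pK; apply: (qcs_comm sL).
have piXn (y : Q) n : ((\pi_(ab Q) y)%qT *+ n)%R = (\pi_(ab Q) (y ^+ n))%qT.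
  elim: n => [|n IHn] //; rewrite mulrS IHn expgS.
  by rewrite -[LHS](pi_abM y).
have qQ (u : ab Q) : (u *+ q = 0)%R.
  elim/quotW: u => y; have [v <-] := psurj y.
  rewrite piXn -gmulfXn; suff /pK -> : lower_qcentral q 1 (v ^+ q) by [].
  exact: (qcs_exp sL).
have := ha k (tens (\pi_(ab H) x)%qT 1%R).
rewrite /ab_mod_map tensor_mapE /= ab_mapE.
move/(tens1_eq_additive (ab_map p) q1 qQ).
rewrite /= !ab_mapE => /ab_eqP/asboolP/abQ /= e.
by apply/(ker_eq pK); move/mulg1_eq: e; rewrite invgK.
Qed.

(** * The semidirect product *)

Section SemidirectProduct.
Variables (q : nat) (K H : groupType) (a : aut_action K H).

Definition sdinl (h : H) : sdprod a := (h, 1).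
Definition sdinr (k : K) : sdprod a := (1, k).

Fact sdinl_morphism : monoid.monoid_morphism sdinl.
Proof. by split=> // x y; congr pair; rewrite /= ?aut_act1 ?mul1g. Qed.

Fact sdinr_morphism : monoid.monoid_morphism sdinr.
Proof. by split=> // x y; congr pair; rewrite /= gmulf1 mul1g. Qed.

HB.instance Definition _ := isUMagmaMorphism.Build H (sdprod a) sdinl sdinl_morphism.
HB.instance Definition _ := isUMagmaMorphism.Build K (sdprod a) sdinr sdinr_morphism.

Lemma sdprodE (x : sdprod a) : x = sdinl x.1 * sdinr x.2.
Proof. by case: x => h k; congr pair; rewrite /= ?gmulf1 ?mulg1 ?mul1g. Qed.

Lemma sdinlJ h g : sdinl h ^ g = sdinl (a g.2^-1 (h ^ g.1)).
Proof.
rewrite [g in LHS]sdprodE conjgM -gmulfJ.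
by congr pair; rewrite /= ?gmulf1 ?aut_act1 ?invg1 ?gmulf1 ?mul1g ?mulg1 ?mulVg.
Qed.

Hypothesis trivial_mod : forall k h, lower_qcentral q 1 (h^-1 * a k h).

(** The first factor contributes a q-central series of the whole semidirect
    product, and not only of H, since K acts trivially on all factors. *)
Lemma sdinl_qcentral_series :
  qcentral_series q (fun n => sdinl @` lower_qcentral q n).
Proof.
have sL := lower_qcentral_series q H.
split=> [n|n _ [h Lh <-]|n _ g [h Lh <-]|n _ [h Lh <-]].
- split; first by exists 1; [apply: (qcs_subgrp sL n).1 | rewrite gmulf1].
  move=> _ _ [h Lh <-] [h' Lh' <-]; exists (h / h'); last by rewrite gmulfF.
  exact: (qcs_subgrp sL n).2.
- by exists h => //; apply: (qcs_decr sL).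
- have Lu : lower_qcentral q n (h ^ g.1) by apply: (qcs_normal n sL).2.
  exists ([~ h, g.1] * ((h ^ g.1)^-1 * a g.2^-1 (h ^ g.1))).
    apply: (subgrpM (qcs_subgrp sL n.+1)); first exact: (qcs_comm sL).
    exact: (lower_qcentral_action (trivial_mod _)).
  by rewrite [RHS]commgEl sdinlJ commgEl -mulgA mulVKg gmulfM gmulfV.
- by exists (h ^+ q); [apply: (qcs_exp sL) | rewrite gmulfXn].
Qed.

(** Let F be the image in the product of the series of H. Modulo F n.+1, the
    component in H of an element of the n-th term is central and killed by q,
    and by qcentral_shift its component in K commutes with H. So commutators
    and q-th powers are congruent to those of the components in K. *)
Lemma sdprod_qcentral_series :
  qcentral_series q (fun n => [set x : sdprod a |
     lower_qcentral q n x.1 /\ lower_qcentral q n x.2]).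
Proof.
have sLH := lower_qcentral_series q H; have sLK := lower_qcentral_series q K.
have sF := sdinl_qcentral_series.
have snd_commg (x y : sdprod a) : [~ x, y].2 = [~ x.2, y.2] by [].
have snd_exp (x : sdprod a) m : (x ^+ m).2 = x.2 ^+ m.
  by elim: m => // m IHm; rewrite !expgS -IHm.
(* Both congruences are used through this: an element congruent to its
   component in K has its component in H in the kernel. *)
have fst_mod n (Q : groupType) (p : ghom (sdprod a) Q) (x : sdprod a) :
    (forall y, p y = 1 <-> (sdinl @` lower_qcentral q n) y) ->
    p x = p (sdinr x.2) -> lower_qcentral q n x.1.
  move=> pK; rewrite [in LHS](sdprodE x) gmulfM => px.
  have /pK [h Lh /(congr1 fst) /= <- //] : p (sdinl x.1) = 1.
  by apply: (@mulIg _ (p (sdinr x.2))); rewrite mul1g.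
split=> [n|n x [Lx1 Lx2]|n x g [Lx1 Lx2]|n x [Lx1 Lx2]].
- have [LH1 LHF] := qcs_subgrp sLH n; have [LK1 LKF] := qcs_subgrp sLK n.
  split=> // x y [Lx1 Lx2] [Ly1 Ly2]; split; last exact: LKF.
  apply: (subgrpM (qcs_subgrp sLH n)) => //; do 2! apply: (lower_qcentral_map (a _)).
  exact: (subgrpV (qcs_subgrp sLH n)).
- by split; [apply: (qcs_decr sLH) | apply: (qcs_decr sLK)].
- split; last exact: (qcs_comm sLK).
  have [Q [p [_ pK]]] := quotient_exists (qcs_normal n.+1 sF).
  apply: (fst_mod _ _ _ _ pK); rewrite snd_commg.
  have Fx : (sdinl @` lower_qcentral q n) (sdinl x.1) by exists x.1.
  have xC y : commute (p (sdinl x.1)) (p y).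
    by apply/(ker_commute pK); apply: (qcs_comm sF).
  have kC : commute (p (sdinr x.2)) (p (sdinl g.1)).
    apply/commute_sym/(ker_commute pK).
    apply: (qcentral_shift sF (n := 0)); first by exists g.1.
    exact: lower_qcentral_map.
  (* With X, Y, Z, W the images of the components of x and g, X is central and
     Y commutes with Z, so [~ X * Y, Z * W] = [~ Y, W]. *)
  rewrite [in LHS](sdprodE x) [in LHS](sdprodE g) !gmulfR !gmulfM.
  rewrite commgEl conjMg invgM -gmulfM (commute_conjg (xC _)) gmulfM.
  by rewrite -mulgA mulKg conjgM (commute_conjg kC) -commgEl.
- split; last by rewrite snd_exp; apply: (qcs_exp sLK).
  have [Q [p [_ pK]]] := quotient_exists (qcs_normal n.+1 sF).
  apply: (fst_mod _ _ _ _ pK); rewrite snd_exp [in LHS](sdprodE x).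
  have Fx : (sdinl @` lower_qcentral q n) (sdinl x.1) by exists x.1.
  have px : p (sdinl x.1) ^+ q = 1.
    by rewrite -gmulfXn; apply/pK; apply: (qcs_exp sF).
  rewrite gmulfXn gmulfM expgMn ?px ?mul1g ?gmulfXn //.
  by apply/(ker_commute pK); apply: (qcs_comm sF).
Qed.

End SemidirectProduct.

Theorem corollary7p26 (q : nat) (hq : (2 <= q)%N) (K H : groupType)
    (a : aut_action K H) (ha : trivial_on_ab_mod q a) :
  RTN q (sdprod a) <-> (RTN q H /\ RTN q K).
Proof.
have trivial_mod := trivial_on_ab_mod_lower_qcentral hq ha.
rewrite !RTN_lower_qcentral; split=> [sepG|[sepH sepK] x x1].
  split=> [h h1|k k1].
    have [|n Ln] := sepG (sdinl a h); first by case.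
    by exists n => /(lower_qcentral_map (@sdinl K H a)).
  have [|n Ln] := sepG (sdinr a k); first by case.
  by exists n => /(lower_qcentral_map (@sdinr K H a)).
have sub n : lower_qcentral q n x ->
    lower_qcentral q n x.1 /\ lower_qcentral q n x.2.
  exact: (lower_qcentral_min (sdprod_qcentral_series trivial_mod)).
have [x2|/sepK[n Ln]] := EM (x.2 = 1); last by exists n => /sub[].
have [|n Ln] := sepH x.1; last by exists n => /sub[].
by move=> h1; apply: x1; rewrite (sdprodE x) h1 x2 !gmulf1 mul1g.
Qed.
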